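(* Every complete locally quasi-convex locally minimal abelian group is almost minimal. In particular, every locally compact abelian (Hausdorff) group is almost minimal.
   Context: Let $\mathbb{T}=\mathbb{R}/\mathbb{Z}$, $q:\mathbb{R}\to\mathbb{T}$ the canonical projection and $\mathbb{T}_+=q([-1/4,1/4])$. For a topological abelian group $G$, $G^\wedge$ is the group of continuous homomorphisms $G\to\mathbb{T}$. A subset $A\subseteq G$ is quasi-convex if for every $x\in G\setminus A$ there is $\chi\in G^\wedge$ with $\chi(A)\subseteq\mathbb{T}_+$ and $\chi(x)\notin\mathbb{T}_+$. A topological abelian group is locally quasi-convex if it has a basis of neighborhoods of $0$ consisting of quasi-convex sets. A Hausdorff topological group $(G,\tau)$ is minimal if there is no Hausdorff group topology on $G$ strictly coarser than $\tau$; it is locally minimal if there exists a neighborhood $V$ of $0$ such that whenever $\sigma\subseteq\tau$ is a Hausdorff group topology on $G$ for which $V$ is a $\sigma$-neighborhood of $0$, then $\sigma=\tau$. For a symmetric subset $U\ni 0$ of an abelian group $G$ and $n\ge1$, $(1/n)U:=\{x\in G: kx\in U\ \forall k\in\{1,\dots,n\}\}$. A Hausdorff topological group is UFSS if for some symmetric neighborhood $U$ of $0$ the sets $(1/n)U$, $n\ge1$, form a neighborhood basis at $0$. A topological group $G$ is almost minimal if it has a closed normal subgroup $N$ which is minimal (in the subspace topology) such that $G/N$ is UFSS. Complete means complete in the natural group uniformity. *)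

(* Defs.v *)
From HB Require Import structures.
From mathcomp Require Import all_boot all_order all_algebra.
From mathcomp Require Import all_classical all_reals.
From mathcomp Require Import topology normedtype.

Set Implicit Arguments.
Unset Strict Implicit.
Unset Printing Implicit Defensive.

Import Order.TTheory GRing.Theory Num.Theory.
Import numFieldNormedType.Exports.

Local Open Scope classical_set_scope.
Local Open Scope ring_scope.
Local Open Scope quotient_scope.

Lemma nbhs_sub (G : topologicalZmodType) (x y : G) (U : set G) :
  nbhs (x - y) U ->
  exists V W, [/\ nbhs x V, nbhs y W & forall a b, V a -> W b -> U (a - b)].
Proof.
move=> /(@sub_continuous G (x, y)) [[V W] /= [Vx Wy]] VWU.
by exists V, W; split => // a b Va Wb; exact: (VWU (a, b)).
Qed.

Lemma nbhs_shift (G : topologicalZmodType) (z x : G) (U : set G) :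
  nbhs (x - z) U -> nbhs x [set y | U (y - z)].
Proof.
move=> /nbhs_sub[V [W [Vx Wz VWU]]].
by apply: filterS Vx => y Vy; apply: VWU => //; exact: nbhs_singleton.
Qed.

Definition quotient_group (G : topologicalZmodType) (N : zmodClosed G) : Type :=
  quotient_topology {ideal_quot N}.

HB.instance Definition _ (G : topologicalZmodType) (N : zmodClosed G) :=
  Topological.copy (quotient_group N) (quotient_topology {ideal_quot N}).
(* Not a copy of the instance on {ideal_quot N}: quotient_topology carries its
   own eqType and choiceType structures, which are not convertible to those of
   {ideal_quot N}. *)
HB.instance Definition _ (G : topologicalZmodType) (N : zmodClosed G) :=
  GRing.isZmodule.Build (quotient_group N)
    (@Quotient.addqA G N) (@Quotient.addqC G N)
    (@Quotient.add0q G N) (@Quotient.addNq G N).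

Definition quotient_map (G : topologicalZmodType) (N : zmodClosed G) :
  G -> quotient_group N := \pi_({ideal_quot N}).

Lemma quotient_mapB (G : topologicalZmodType) (N : zmodClosed G) :
  {morph @quotient_map G N : x y / x - y}.
Proof. exact: (raddfB \pi_({ideal_quot N})). Qed.

Lemma quotient_map_surj (G : topologicalZmodType) (N : zmodClosed G)
  (u : quotient_group N) : exists x, u = quotient_map N x.
Proof. by exists (repr (u : {ideal_quot N})); rewrite /quotient_map reprK. Qed.

Lemma quotient_map_eq (G : topologicalZmodType) (N : zmodClosed G) (x y : G) :
  quotient_map N x = quotient_map N y <-> x - y \in N.
Proof.
split=> [xy|xyN].
  have /eqP : \pi_({ideal_quot N}) x = \pi_({ideal_quot N}) y by [].
  by rewrite -Quotient.idealrBE.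
suff : \pi_({ideal_quot N}) x = \pi_({ideal_quot N}) y by [].
by apply/eqP; rewrite -Quotient.idealrBE.
Qed.

Lemma open_quotient (G : topologicalZmodType) (N : zmodClosed G)
  (U : set (quotient_group N)) : open U = open (quotient_map N @^-1` U).
Proof. by []. Qed.

Lemma quotient_map_continuous (G : topologicalZmodType) (N : zmodClosed G) :
  continuous (quotient_map N).
Proof. exact: pi_continuous. Qed.

Lemma quotient_map_open (G : topologicalZmodType) (N : zmodClosed G) (x : G)
  (U : set G) : nbhs x U -> nbhs (quotient_map N x) (quotient_map N @` U).
Proof.
rewrite nbhsE => -[V [oV Vx] VU].
rewrite nbhsE; exists (quotient_map N @` V); last exact: image_subset.
split; last by exists x.
rewrite open_quotient openE => y [v Vv /quotient_map_eq vy].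
have /nbhs_shift : nbhs (y - (y - v)) V by rewrite subKr; exact: open_nbhs_nbhs.
apply: filterS => z Vz; exists (z - (y - v)) => //.
by apply/quotient_map_eq; rewrite addrAC subrr sub0r opprB.
Qed.

Lemma quotient_sub_continuous (G : topologicalZmodType) (N : zmodClosed G) :
  continuous (fun x : quotient_group N * quotient_group N => x.1 - x.2).
Proof.
move=> [u v] W /=.
have [x ->] := quotient_map_surj u; have [y ->] := quotient_map_surj v.
rewrite -quotient_mapB => /quotient_map_continuous /nbhs_sub[A [B [Ax By ABW]]].
exists (quotient_map N @` A, quotient_map N @` B).
  by split; exact: quotient_map_open.
by move=> [_ _] [/= [a Aa <-] [b Bb <-]]; rewrite -quotient_mapB; exact: ABW.
Qed.

HB.instance Definition _ (G : topologicalZmodType) (N : zmodClosed G) :=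
  PreTopologicalNmodule_isTopologicalZmodule.Build (quotient_group N)
    (@quotient_sub_continuous G N).

Definition subgroup (G : topologicalZmodType) (N : zmodClosed G) : Type :=
  {x : G | x \in N}.

HB.instance Definition _ (G : topologicalZmodType) (N : zmodClosed G) :=
  SubChoice.on (subgroup N).
HB.instance Definition _ (G : topologicalZmodType) (N : zmodClosed G) :=
  [SubChoice_isSubZmodule of (subgroup N) by <:].
HB.instance Definition _ (G : topologicalZmodType) (N : zmodClosed G) :=
  Topological.copy (subgroup N) (initial_topology (val : subgroup N -> G)).

Lemma subgroup_sub_continuous (G : topologicalZmodType) (N : zmodClosed G) :
  continuous (fun x : subgroup N * subgroup N => x.1 - x.2).
Proof.
move=> [x y] W /= [_ [[O oO <-] /= Oxy OW]].
have : nbhs (val x - val y) O by exact: open_nbhs_nbhs.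
move=> /nbhs_sub[A [B [Ax By ABO]]].
have vc : continuous (val : subgroup N -> G).
  exact: (@initial_continuous (subgroup N) G).
exists (val @^-1` A, val @^-1` B); first by split; exact: vc.
by move=> [a b] [/= Aa Bb]; apply: OW; exact: ABO.
Qed.

HB.instance Definition _ (G : topologicalZmodType) (N : zmodClosed G) :=
  PreTopologicalNmodule_isTopologicalZmodule.Build (subgroup N)
    (@subgroup_sub_continuous G N).

(* A topology as a family of open sets, so that several topologies on the same
   carrier can be compared by inclusion. *)
Record topology_on (T : Type) := TopologyOn {
  topen : set (set T);
  topenT : topen setT;
  topenI : setI_closed topen;
  topen_bigU : forall (I : Type) (f : I -> set T),
    (forall i, topen (f i)) -> topen (\bigcup_i f i)
}.

Definition topologized (T : Type) (s : topology_on T) : Type := T.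

HB.instance Definition _ (T : choiceType) (s : topology_on T) :=
  Choice.copy (topologized s) T.
HB.instance Definition _ (T : choiceType) (s : topology_on T) :=
  isOpenTopological.Build (topologized s)
    (@topenT T s) (@topenI T s) (@topen_bigU T s).
HB.instance Definition _ (G : zmodType) (s : topology_on G) :=
  GRing.Zmodule.copy (topologized s) G.

Definition hausdorff_group_topology (G : zmodType) (s : topology_on G) : Prop :=
  continuous (fun x : topologized s * topologized s => x.1 - x.2) /\
  hausdorff_space (topologized s).

Definition minimal (G : topologicalZmodType) : Prop :=
  hausdorff_space G /\
  ~ exists s : topology_on G, hausdorff_group_topology s /\ topen s `<` @open G.

Definition locally_minimal (G : topologicalZmodType) : Prop :=
  hausdorff_space G /\
  exists2 V : set G, nbhs 0 V &
    forall s : topology_on G, hausdorff_group_topology s ->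
      topen s `<=` @open G -> nbhs (0 : topologized s) V -> topen s = @open G.

Definition nbhs_basis (T : topologicalType) (x : T) (B : set (set T)) : Prop :=
  B `<=` nbhs x /\ forall W, nbhs x W -> exists2 V, B V & V `<=` W.

Definition one_nth (G : zmodType) (n : nat) (U : set G) : set G :=
  [set x | forall k, (0 < k <= n)%N -> U (x *+ k)].

Definition UFSS (G : topologicalZmodType) : Prop :=
  hausdorff_space G /\
  exists U : set G, [/\ nbhs 0 U, (forall x, U x -> U (- x)) &
    nbhs_basis 0 [set one_nth n U | n in [set n | (0 < n)%N]]].

(* All groups being abelian, every subgroup is normal. *)
Definition almost_minimal (G : topologicalZmodType) : Prop :=
  exists N : zmodClosed G,
    [/\ closed [set x | x \in N], minimal (subgroup N) & UFSS (quotient_group N)].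

(* An alias of G carrying its natural group uniformity. *)
Definition group_uniformity (G : topologicalZmodType) : Type := G.

HB.instance Definition _ (G : topologicalZmodType) :=
  Nbhs.copy (group_uniformity G) G.

Definition group_entourage (G : topologicalZmodType) : set_system (G * G) :=
  filter_from (nbhs (0 : G)) (fun U => [set xy | U (xy.1 - xy.2)]).

Section GroupUniformity.
Local Open Scope relation_scope.
Context (G : topologicalZmodType).

Lemma group_entourage_filter : Filter (@group_entourage G).
Proof.
apply: filter_from_filter; first by exists setT; exact: filterT.
by move=> U V U0 V0; exists (U `&` V) => //; exact: filterI.
Qed.

Lemma group_entourage_diagonal (A : set (G * G)) :
  group_entourage A -> diagonal `<=` A.
Proof.
move=> [U U0 UA] [x y] /diagonalP ->; apply: UA => /=.
by rewrite subrr; exact: nbhs_singleton.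
Qed.

Lemma group_entourage_inv (A : set (G * G)) :
  group_entourage A -> group_entourage A^-1.
Proof.
move=> [U U0 UA]; exists (-%R @^-1` U).
  by apply: (@opp_continuous G); rewrite oppr0.
by move=> [x y] /= Uxy; apply: UA; rewrite /= -opprB.
Qed.

Lemma group_entourage_split (A : set (G * G)) :
  group_entourage A -> exists2 B, group_entourage B & B \; B `<=` A.
Proof.
move=> [U U0 UA].
have : nbhs (0 - 0 : G) U by rewrite subr0.
move=> /nbhs_sub[V [W [V0 W0 VWU]]].
exists [set xy | (V `&` (-%R @^-1` W)) (xy.1 - xy.2)].
  exists (V `&` (-%R @^-1` W)) => //; apply: filterI => //.
  by apply: (@opp_continuous G); rewrite oppr0.
move=> [x z] [y /= [Vxy _] [_ Wyz]]; apply: UA => /=.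
by rewrite -(subrKA y) -[y - z]opprK; exact: VWU.
Qed.

Lemma nbhs_group_entourage :
  @nbhs _ (group_uniformity G) = nbhs_ (@group_entourage G).
Proof.
apply/funext => x; apply/seteqP; split=> A /=.
  move=> xA; exists [set xy | A (x - (xy.1 - xy.2))].
    exists [set u | A (x - u)] => //.
    have : nbhs (x - 0 : G) A by rewrite subr0.
    move=> /nbhs_sub[V [W [Vx W0 VWA]]]; apply: filterS W0 => w Ww.
    by apply: VWA => //; exact: nbhs_singleton.
  by move=> y /xsectionP; rewrite /= subKr.
move=> [E [U U0 UE] EA].
have : nbhs (x - x : G) U by rewrite subrr.
move=> /nbhs_sub[V [W [Vx Wx VWU]]]; apply: (filterS _ Wx) => w Ww.
apply: EA; apply/xsectionP; apply: UE; apply: VWU => //.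
exact: nbhs_singleton.
Qed.

End GroupUniformity.

HB.instance Definition _ (G : topologicalZmodType) :=
  Nbhs_isUniform.Build (group_uniformity G) (@group_entourage_filter G)
    (@group_entourage_diagonal G) (@group_entourage_inv G)
    (@group_entourage_split G) (@nbhs_group_entourage G).

Definition complete_group (G : topologicalZmodType) : Prop :=
  forall F : set_system (group_uniformity G), ProperFilter F ->
    cauchy F -> exists x : group_uniformity G, F --> x.

Definition integers (R : realType) : {pred R} := [pred x | x \is a Num.int].
Arguments integers : clear implicits.

Lemma integers_zmod_closed (R : realType) : zmod_closed (integers R).
Proof. by split=> [|x y]; rewrite !inE; [exact: rpred0|exact: rpredB]. Qed.

HB.instance Definition _ (R : realType) :=
  GRing.isZmodClosed.Build R (integers R) (@integers_zmod_closed R).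

Definition circle (R : realType) : topologicalZmodType :=
  quotient_group (integers R).

Definition circle_plus (R : realType) : set (circle R) :=
  [set quotient_map (integers R) t | t in `[- (1 / 4), 1 / 4]].
Arguments circle_plus : clear implicits.

Definition quasi_convex (R : realType) (G : topologicalZmodType) (A : set G) :
    Prop :=
  forall x, ~ A x -> exists chi : {additive G -> circle R},
    [/\ continuous chi, chi @` A `<=` circle_plus R &
        ~ circle_plus R (chi x)].

Definition locally_quasi_convex (R : realType) (G : topologicalZmodType) :
    Prop :=
  exists2 B : set (set G), nbhs_basis 0 B & forall A, B A -> quasi_convex R A.

(* Main.v *)
Require Import Defs.
From HB Require Import structures.
From mathcomp Require Import all_boot all_order all_algebra.
From mathcomp Require Import all_classical all_reals.
From mathcomp Require Import topology normedtype.
From mathcomp Require Import zify lra.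

(* In both parts we find a subgroup N and a symmetric neighbourhood V of 0 with
   V + N = V such that every ultrafilter containing all (1/n)V converges to a
   point of N. Then N is compact, hence minimal, and every neighbourhood of N
   contains some (1/n)V, so that the image of V witnesses that G/N is UFSS.

   First part: let U be a quasi-convex neighbourhood of 0 contained in a witness
   of local minimality. The sets (1/n)U and the continuous characters generate a
   Hausdorff group topology coarser than that of G, so it is the topology of G.
   Since the circle is compact, an ultrafilter containing all (1/n)U is Cauchy;
   as G is complete, it converges to a point of the intersection N of these
   sets.

   Second part, without duality theory: let H be the open subgroup generated by
   a compact neighbourhood U, and N the subgroup of those elements of H whose
   multiples stay in a compact set. Weil's lemma on monothetic subgroups shows
   that H is the sum of a compact set and of a discrete copy of Z^r. The
   Z^r-coordinate of x in N is additive up to a bounded error and bounded along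
   the multiples of x, so it is bounded by a constant independent of x and N is
   compact. Finally V = U + N is compact, and an element of all (1/n)V lies in
   N. *)

Set Implicit Arguments.
Unset Strict Implicit.
Unset Printing Implicit Defensive.

Import Order.TTheory GRing.Theory Num.Theory.
Import numFieldNormedType.Exports.

Local Open Scope classical_set_scope.
Local Open Scope ring_scope.

(** * Compact subgroups with UFSS quotient *)

Lemma zmodClosed_of_set (G : zmodType) (A : set G) :
    A 0 -> (forall x y, A x -> A y -> A (x - y)) ->
  exists N : zmodClosed G, [set x | x \in N] = A.
Proof.
move=> A0 AB; pose S : {pred G} := [pred x | x \in A].
have zS : zmod_closed S by split=> [|x y]; rewrite !inE //; exact: AB.
pose m := GRing.isZmodClosed.Build G S zS.
pose N : zmodClosed G := HB.pack S m.
by exists N; apply/seteqP; split=> x /=; rewrite !inE.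
Qed.

Lemma ultra_fmap (T U : Type) (f : T -> U) (F : set_system T) :
  UltraFilter F -> UltraFilter (f @ F : set_system U).
Proof.
move=> FU; split=> [|H PH FH]; first exact: fmap_proper_filter.
apply/seteqP; split=> A; last exact: FH.
move=> HA; have [//|FA] := in_ultra_setVsetC (f @^-1` A) FU.
have : H (A `&` ~` A) by apply: filterI => //; exact: FH.
by rewrite setICr => /filter_ex[].
Qed.

Section TopologicalGroup.
Variable G : topologicalZmodType.
Implicit Types (A B H U V W K : set G) (N : zmodClosed G).

Lemma nbhs0_sub U : nbhs 0 U ->
  exists V, [/\ nbhs 0 V, forall x, V x -> V (- x) &
    forall x y, V x -> V y -> U (x - y)].
Proof.
rewrite -{1}(subr0 0) => /nbhs_sub[V [W [V0 W0 VWU]]].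
exists ((V `&` W) `&` -%R @^-1` (V `&` W)); split.
- apply: filterI; first exact: filterI.
  by apply: (@opp_continuous G); rewrite oppr0; exact: filterI.
- by move=> x [? ?]; split; rewrite /= ?opprK.
- by move=> x y [[Vx _] _] [[_ Wy] _]; exact: VWU.
Qed.

Lemma nbhs0_shift U x : nbhs 0 U -> nbhs x [set y | U (y - x)].
Proof. by rewrite -(subrr x); exact: nbhs_shift. Qed.

Lemma mulrn_continuous k : continuous (fun x : G => x *+ k).
Proof.
elim: k => [|k IH] x; first by rewrite (_ : (fun _ => _) = cst 0);
  [exact: cvg_cst|apply/funext => y; rewrite mulr0n].
rewrite (_ : (fun _ => _) = (fun z : G * G => z.1 + z.2) \o
  (fun y : G => (y, y *+ k))); last by apply/funext => y /=; rewrite mulrS.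
apply: continuous_comp; last exact: add_continuous.
by apply: cvg_pair => //=; exact: IH.
Qed.

Lemma nbhs_one_nth n U : nbhs 0 U -> nbhs 0 (one_nth n U).
Proof.
move=> U0; elim: n => [|n IH].
  by apply: filterS filterT => x _ k; rewrite leqn0 lt0n => /andP[/negPf->].
have nS : nbhs 0 ((fun x => x *+ n.+1) @^-1` U).
  by apply: mulrn_continuous; rewrite mul0rn.
apply: filterS2 IH nS => x nx Sx k /andP[k0].
rewrite leq_eqVlt => /predU1P[->//|kn].
by apply: nx; rewrite k0.
Qed.

Lemma one_nth_le m n U : (m <= n)%N -> one_nth n U `<=` one_nth m U.
Proof.
by move=> mn x nx k /andP[k0 km]; apply: nx; rewrite k0 (leq_trans km).
Qed.

Lemma one_nthS n U V : U `<=` V -> one_nth n U `<=` one_nth n V.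
Proof. by move=> UV x nx k /nx /UV. Qed.

Lemma closed_preimage_mulrn K k : closed K -> closed [set x : G | K (x *+ k)].
Proof. by apply: closed_comp => x _; exact: mulrn_continuous. Qed.

(** If [x] is in the closure, [x + U] meets [H] in some [y], and [x = y - (y - x)] with [y - x] in
    [U]. *)
Lemma open_subgroup_closed H U : nbhs 0 U -> U `<=` H ->
  (forall x y, H x -> H y -> H (x - y)) -> closed H.
Proof.
move=> U0 UH HB x clx.
have [y [Hy Uy]] := clx _ (nbhs0_shift x U0).
by rewrite -(subKr y x); apply: HB => //; exact: UH.
Qed.

Lemma one_nth_closed n V : closed V -> closed (one_nth n V).
Proof.
move=> cV; rewrite (_ : one_nth n V =
    \bigcap_(k in [set k | (0 < k <= n)%N]) [set x | V (x *+ k)]) //.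
by apply: closed_bigI => k _; exact: closed_preimage_mulrn.
Qed.

Lemma quotient_map0 N : quotient_map N 0 = 0.
Proof. by rewrite -(subrr (0 : G)) quotient_mapB subrr. Qed.

Lemma quotient_mapN N x : quotient_map N (- x) = - quotient_map N x.
Proof. by rewrite -(sub0r x) quotient_mapB quotient_map0 sub0r. Qed.

Lemma quotient_mapMn N x k : quotient_map N (x *+ k) = quotient_map N x *+ k.
Proof.
elim: k => [|k IH]; first by rewrite !mulr0n quotient_map0.
rewrite !mulrS -IH -[in LHS](opprK (x *+ k)).
by rewrite quotient_mapB quotient_mapN opprK.
Qed.

Lemma quotient_hausdorff N :
  closed [set x | x \in N] -> hausdorff_space (quotient_group N).
Proof.
move=> cN u v; have [x ->] := quotient_map_surj u.
have [y ->] := quotient_map_surj v => uv; apply/quotient_map_eq.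
apply: contrapT => xyN.
have : nbhs (x - y) (~` [set x | x \in N]).
  by apply: open_nbhs_nbhs; split=> //; exact: closed_openC.
move=> /nbhs_sub[V [W [Vx Wy VW]]].
have [_ [[a Va <-] [b Wb /esym/quotient_map_eq ab]]] :=
  uv _ _ (quotient_map_open N Vx) (quotient_map_open N Wy).
exact: (VW a b).
Qed.

Lemma subgroup_compact N :
  compact [set x | x \in N] -> compact [set: subgroup N].
Proof.
rewrite compact_ultra => cN; rewrite compact_ultra => F FU _.
have Fval := ultra_fmap (val : subgroup N -> G) FU.
have [|x [/= xN Fx]] := cN (val @ F) Fval.
  rewrite /= /fmap /= (_ : _ @^-1` _ = setT); first exact: filterT.
  by apply/seteqP; split=> // y _; exact: (valP y).
exists (exist _ x xN : subgroup N); split=> // A [_ [[O oO <-] /= Ox OA]].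
apply: filterS OA _; apply: (Fx O); exact: open_nbhs_nbhs.
Qed.

(** The identity onto a coarser Hausdorff topology maps closed sets, which are compact, to compact
    and hence closed sets. *)
Lemma compact_minimal :
  hausdorff_space G -> compact [set: G] -> minimal G.
Proof.
move=> hG cG; split=> // -[s [[_ hs] [/= sG nGs]]]; apply: nGs => O oO.
pose f (x : G) : topologized s := x.
have fc : continuous f.
  by apply/continuousP => A; exact: sG.
have : compact (f @` ~` O).
  apply: continuous_compact; first exact: continuous_subspaceT.
  by rewrite -(setTI (~` O)); apply: compact_closedI => //; exact: open_closedC.
suff -> : f @` (~` O) = (~` O : set (topologized s)).
  by move=> /(compact_closed hs); rewrite closedC.
by apply/seteqP; split=> [_ [x Ox <-]//|x Ox]; exists x.
Qed.

End TopologicalGroup.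

Lemma subgroup_hausdorff (G : topologicalZmodType) (N : zmodClosed G) :
  hausdorff_space G -> hausdorff_space (subgroup N).
Proof.
move=> hG x y xy; apply: val_inj; apply: hG => A B Ax By.
have vc : continuous (val : subgroup N -> G).
  exact: (@initial_continuous (subgroup N) G).
have [z [Az Bz]] := xy _ _ (vc x A Ax) (vc y B By).
by exists (val z).
Qed.

Lemma almost_minimal_ultra (G : topologicalZmodType) (N : zmodClosed G)
    (V : set G) :
  hausdorff_space G ->
  nbhs 0 V -> (forall x, V x -> V (- x)) ->
  (forall x y, V x -> y \in N -> V (x + y)) ->
  (forall F : set_system G, UltraFilter F ->
     (forall n, F (one_nth n V)) -> exists2 y, y \in N & F --> y) ->
  almost_minimal G.
Proof.
move=> hG V0 symV VN lim.
have NV x n : x \in N -> one_nth n V x.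
  move=> xN k _; rewrite -[_ *+ _]add0r; apply: VN; last exact: rpredMn.
  exact: nbhs_singleton.
have cN : compact [set x | x \in N].
  rewrite compact_ultra => F FU FN.
  have [|y yN Fy] := lim F FU; last by exists y.
  by move=> n; apply: filterS FN => x /NV.
(* Otherwise the sets (1/n)V minus [N + W] generate a proper filter. An ultrafilter above it
   converges to some [y] in [N], hence contains [y + W], which those sets avoid. *)
have VW W : nbhs 0 W -> exists2 n, (0 < n)%N &
    one_nth n V `<=` [set x | exists2 y, y \in N & W (x - y)].
  move=> W0; apply: contrapT => noW.
  pose B n := one_nth n V `\` [set x | exists2 y, y \in N & W (x - y)].
  have FB : ProperFilter (filter_from [set: nat] B).
    apply: filter_from_proper.
      apply: filter_from_filter; first by exists 0%N.
      move=> m n _ _; exists (maxn m n) => // x [nx Wx].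
      by split; split=> //; apply: one_nth_le nx; rewrite ?leq_maxl ?leq_maxr.
    move=> n _; apply: contrapT => B0; apply: noW; exists n.+1 => // x nx.
    apply: contrapT => Wx; apply: B0; exists x; split=> //.
    exact: (one_nth_le (leqnSn n)).
  have [F [FU BF]] := ultraFilterLemma FB.
  have [n|y yN Fy] := lim F FU; first by apply: BF; exists n => // x [].
  have FB0 : F (B 0%N) by apply: BF; exists 0%N.
  have [x [[_ nWx] Wx]] := filter_ex (filterI FB0 (Fy _ (nbhs0_shift y W0))).
  by apply: nWx; exists y.
have clN := compact_closed hG cN.
exists N; split=> //.
  apply: compact_minimal; [exact: subgroup_hausdorff|exact: subgroup_compact].
(* [V] is a union of cosets of [N], so membership in (1/n)V can be tested in the quotient. *)
have piV x : (quotient_map N @` V) (quotient_map N x) -> V x.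
  move=> [v Vv /esym/quotient_map_eq xv].
  by rewrite -(subrK v x) addrC; exact: VN.
split; first exact: quotient_hausdorff.
exists (quotient_map N @` V); split.
- by have := quotient_map_open N V0; rewrite quotient_map0.
- move=> _ [x Vx <-]; exists (- x); first exact: symV.
  by rewrite quotient_mapN.
split=> [_ [n n0 <-]|W].
  have := quotient_map_open N (nbhs_one_nth n V0); rewrite quotient_map0.
  apply: filterS => _ [x nx <-] k kn.
  by rewrite -quotient_mapMn; exists (x *+ k) => //; exact: nx.
rewrite -(quotient_map0 N) => /quotient_map_continuous/VW[n n0 nW].
exists (one_nth n (quotient_map N @` V)); first by exists n.
move=> u; have [x ->] := quotient_map_surj u => nx.
have [k kn|y yN] := nW x.
  by apply: piV; rewrite quotient_mapMn; exact: nx.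
suff -> : quotient_map N x = quotient_map N (x - y) by [].
by apply/quotient_map_eq; rewrite subKr.
Qed.

(** * The circle group and quasi-convex sets *)

Section Circle.
Variable R : realType.
Local Notation q := (quotient_map (integers R)).

Lemma integers_closed : closed [set x : R | x \in integers R].
Proof.
move=> x clx; apply: contrapT => xZ.
have /andP[fx xf] := floor_itv x.
have {} fx : (Num.floor x)%:~R < x.
  rewrite lt_neqAle fx andbT; apply/eqP => e; apply: xZ.
  by rewrite /= inE -e intr_int.
have : \forall y \near x, y \in `](Num.floor x)%:~R, (Num.floor x + 1)%:~R[.
  by apply: near_in_itvoo; rewrite in_itv /= fx.
move=> /clx[y [/= + ]]; rewrite inE => /intrP[m ->].
by rewrite in_itv /= !ltr_int ltzD1; case: ltP.
Qed.

Lemma circle_hausdorff : hausdorff_space (circle R).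
Proof. exact/quotient_hausdorff/integers_closed. Qed.

Lemma segment_image_compact (a b : R) : compact (q @` `[a, b]).
Proof.
apply: continuous_compact; last exact: segment_compact.
by apply: continuous_subspaceT; exact: quotient_map_continuous.
Qed.

Lemma circle_compact : compact [set: circle R].
Proof.
suff <- : q @` `[0, 1] = [set: circle R] by exact: segment_image_compact.
apply/seteqP; split=> // u _; have [x ->] := quotient_map_surj u.
exists (x - (Num.floor x)%:~R).
  have := floor_itv x; rewrite intrD /= in_itv /= => /andP[? ?].
  by apply/andP; split; lra.
by apply/quotient_map_eq; rewrite addrAC subrr sub0r rpredN inE intr_int.
Qed.

Lemma circle_plus_closed : closed (circle_plus R).
Proof.
apply: (compact_closed circle_hausdorff).
exact: (@segment_image_compact (- (1 / 4)) (1 / 4)).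
Qed.

Lemma nbhs0_circle_plus : nbhs 0 (circle_plus R).
Proof.
have : nbhs (0 : R) [set` `[- (1 / 4), 1 / 4]].
  have : \forall y \near (0 : R), y \in `](- (1 / 4) : R), 1 / 4[.
    by apply: near_in_itvoo; rewrite in_itv /=; apply/andP; split; lra.
  by apply: filterS => y; rewrite /= !in_itv /= => /andP[/ltW-> /ltW->].
by move=> /(@quotient_map_open R (integers R)); rewrite quotient_map0.
Qed.

(** If [s] and [r] in [-1/4, 1/4] represent [u] and [u *+ 2], the integer [r - 2s] has absolute
    value at most 3/4, so it is 0 and [s = r/2]. *)
Lemma circle_plus_half u : circle_plus R u -> circle_plus R (u *+ 2) ->
  exists2 s, `|s| <= 1 / 8 & u = q s.
Proof.
move=> [s + <-] [r + ]; rewrite !set_itvE /= => /andP[s1 s2] /andP[r1 r2].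
rewrite -quotient_mapMn => /quotient_map_eq; rewrite inE => /intrP[m rm].
have m0 : m = 0.
  apply/eqP; rewrite eq_le -!ltzD1 -(ltr_int R) -[0 < _](ltr_int R) intrD -rm.
  by rewrite mulr2n; apply/andP; split; lra.
exists s => //; rewrite m0 mulr2n in rm; rewrite ler_norml.
by apply/andP; split; lra.
Qed.

Lemma circle_plus_sub s t :
  `|s| <= 1 / 8 -> `|t| <= 1 / 8 -> circle_plus R (q s - q t).
Proof.
rewrite !ler_norml => /andP[? ?] /andP[? ?]; exists (s - t); last first.
  exact: quotient_mapB.
by rewrite /= in_itv /=; apply/andP; split; lra.
Qed.

(** This stands in for halving a neighbourhood. For [k <= n] both [k] and [2k] are at most [n.*2],
    so a character mapping [U] into T_+ takes [kx] and [ky] into the image of [-1/8, 1/8], and their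
    difference into T_+. *)
Lemma quasi_convex_one_nthB (G : topologicalZmodType) (U : set G) n x y :
  quasi_convex R U -> one_nth n.*2 U x -> one_nth n.*2 U y ->
  one_nth n U (x - y).
Proof.
move=> qU nx ny k /andP[k0 kn]; apply: contrapT => nU.
have [chi [_ chiU]] := qU _ nU; apply.
have half z : one_nth n.*2 U z -> exists2 s, `|s| <= 1 / 8 & chi (z *+ k) = q s.
  move=> nz; apply: circle_plus_half; first apply: chiU.
    exists (z *+ k) => //; apply: nz; rewrite k0 (leq_trans kn) //.
    by rewrite -addnn leq_addr.
  apply: chiU; exists (z *+ (k * 2)); last by rewrite mulrnA raddfMn.
  by apply: nz; rewrite muln_gt0 k0 muln2 leq_double.
have [s s8 sx] := half x nx; have [t t8 ty] := half y ny.
by rewrite mulrnBl raddfB sx ty; exact: circle_plus_sub.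
Qed.

(** [U] is an intersection of preimages of the closed set T_+ under continuous characters. *)
Lemma quasi_convex_closed (G : topologicalZmodType) (U : set G) :
  quasi_convex R U -> closed U.
Proof.
move=> qU x clx; apply: contrapT => /qU[chi [cchi chiU chix]].
apply: chix; apply: circle_plus_closed => A /cchi /clx[y [Uy Ay]].
by exists (chi y); split=> //; apply: chiU; exists y.
Qed.

End Circle.

(** * Complete locally quasi-convex locally minimal groups *)

Section FilterTopology.
Variables (G : zmodType) (F : set_system G).
Hypothesis FF : Filter F.

Definition translate_open : set (set G) :=
  [set O | forall x, O x -> F [set y | O (x + y)]].

Lemma translate_openT : translate_open setT.
Proof. by move=> x _; exact: filterT. Qed.

Lemma translate_openI : setI_closed translate_open.
Proof.
by move=> A B oA oB x [/oA FA /oB FB]; exact: filterI.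
Qed.

Lemma translate_open_bigU (I : Type) (f : I -> set G) :
  (forall i, translate_open (f i)) -> translate_open (\bigcup_i f i).
Proof.
by move=> of_ x [i _ /of_]; apply: filterS => y fy; exists i.
Qed.

Definition filter_topology : topology_on G :=
  TopologyOn translate_openT translate_openI translate_open_bigU.

Hypothesis F0 : forall A, F A -> A 0.
Hypothesis F_sub : forall A, F A ->
  exists2 B, F B & forall x y, B x -> B y -> A (x - y).

Lemma filter_topology_nbhs (x : topologized filter_topology) (A : set G) :
  nbhs x A <-> F [set y | A (x + y)].
Proof.
split=> [[O [oO Ox OA]]|FA].
  by apply: filterS (oO x Ox) => y; exact: OA.
(* The witness is the interior of [A]. It is open because [D - D] inside [C] and 0 in [D] give [-D]
   inside [C], so that [z + C + D] lies in [A]. *)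
exists [set z | F [set y | A (z + y)]]; split=> //; last first.
  by move=> z /F0; rewrite /= addr0.
move=> z /= /F_sub[C FC CA]; have [D FD DC] := F_sub FC.
have D0 := F0 FD.
apply: filterS FC => y Cy; apply: filterS FD => w Dw.
rewrite /= -addrA -[w]opprK; apply: CA => //.
by rewrite -sub0r; exact: DC.
Qed.

Lemma filter_topology_group : (forall x, x != 0 -> exists2 A, F A & ~ A x) ->
  hausdorff_group_topology filter_topology.
Proof.
move=> F_sep; split=> [[x y] W /filter_topology_nbhs/F_sub[C FC CW]|x y xy].
  exists ([set a | C (a - x)], [set b | C (b - y)]).
    split; apply/filter_topology_nbhs; apply: filterS FC => z Cz /=.
      by rewrite addrAC subrr add0r.
    by rewrite addrAC subrr add0r.
  move=> [a b] [/= Ca Cb]; have := CW _ _ Ca Cb; rewrite /=.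
  by rewrite [x - y + _]addrC addrAC subrKA opprB subrKA.
apply/eqP; rewrite -subr_eq0; apply/negPn/negP => /F_sep[A /F_sub[C FC CA] nA].
have [||z [Cx Cy]] := xy [set z | C (z - x)] [set z | C (z - y)].
- apply/filter_topology_nbhs; apply: filterS FC => z.
  by rewrite /= addrAC subrr add0r.
- apply/filter_topology_nbhs; apply: filterS FC => z.
  by rewrite /= addrAC subrr add0r.
by apply: nA; rewrite -(subrKA z) -[x - z]opprB addrC; apply: CA.
Qed.

End FilterTopology.

(** * The topology generated by the sets (1/n)U and the characters *)

Section CharacterFilter.
Variables (R : realType) (G : topologicalZmodType) (U : set G).

(* The filter of neighbourhoods of 0 generated by the sets (1/n)U and the
   continuous characters, as an intersection of filters: this avoids finite
   families of characters, difference maps being handled by pushing filters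
   forward. *)
Definition char_filter : set_system G := [set A |
  forall Phi : set_system G, Filter Phi -> (forall n, Phi (one_nth n U)) ->
    (forall chi : {additive G -> circle R}, continuous chi ->
       chi @ Phi --> 0) ->
  Phi A].

Lemma char_filter_filter : Filter char_filter.
Proof.
split=> [Phi PF _ _|A B FA FB Phi PF PU Pchi|A B AB FA Phi PF PU Pchi].
- exact: filterT.
- by apply: filterI; [exact: FA|exact: FB].
- by apply: filterS AB _; exact: FA.
Qed.

Lemma char_filter_one_nth n : char_filter (one_nth n U).
Proof. by move=> Phi _ PU _. Qed.

Lemma char_filter_char (chi : {additive G -> circle R}) :
  continuous chi -> chi @ char_filter --> 0.
Proof. by move=> cchi A A0 Phi _ _ Pchi; exact: Pchi A0. Qed.

(** The filter [nbhs 0] is itself one of the filters [Phi] being intersected. *)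
Lemma char_filter_nbhs : nbhs 0 U -> char_filter `<=` nbhs 0.
Proof.
move=> U0 A; apply=> [n|chi cchi]; first exact: nbhs_one_nth.
by rewrite -(raddf0 chi); exact: cchi.
Qed.

Hypothesis qU : quasi_convex R U.

(** The image of [Psi] x [Psi] under subtraction is one of the filters [Phi]: quasi-convexity
    handles (1/n)U, and characters tend to [l - l = 0]. With [Psi] the character filter this gives
    continuity of subtraction; with [Psi] an ultrafilter it gives the Cauchy property. *)
Lemma char_filter_difference (Psi : set_system G) : Filter Psi ->
  (forall n, Psi (one_nth n U)) ->
  (forall chi : {additive G -> circle R}, continuous chi ->
     exists l : circle R, chi @ Psi --> l) ->
  forall A, char_filter A ->
    exists2 B, Psi B & forall x y, B x -> B y -> A (x - y).
Proof.
move=> PF PU Pchi A FA.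
pose Phi := (fun z : G * G => z.1 - z.2) @ filter_prod Psi Psi.
have PhiF : Filter Phi by exact: fmap_filter.
have [n|chi cchi W|] := FA Phi PhiF.
- exists (one_nth n.*2 U, one_nth n.*2 U); first by split; exact: PU.
  move=> [x y] [/= nx ny].
  exact: (quasi_convex_one_nthB qU nx ny).
- have [l Pl] := Pchi chi cchi; rewrite -(subrr l).
  move=> /nbhs_sub[V1 [V2 [V1l V2l V12]]].
  exists (chi @^-1` V1, chi @^-1` V2).
    by split; exact: Pl.
  by move=> [x y] [/= V1x V2y]; rewrite raddfB; exact: V12.
move=> [B1 B2] [/= PB1 PB2] BA; exists (B1 `&` B2); first exact: filterI.
by move=> x y [B1x _] [_ B2y]; exact: (BA (x, y)).
Qed.

Lemma char_filter_sub A : char_filter A ->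
  exists2 B, char_filter B & forall x y, B x -> B y -> A (x - y).
Proof.
apply: char_filter_difference.
- exact: char_filter_filter.
- exact: char_filter_one_nth.
- by move=> chi cchi; exists 0; exact: char_filter_char.
Qed.

(** A quasi-convex neighbourhood of 0 missing [x] yields a character with [chi x] outside T_+; the
    preimage of T_+ is the required set. *)
Lemma char_filter_separated : hausdorff_space G -> locally_quasi_convex R G ->
  forall x, x != 0 -> exists2 A, char_filter A & ~ A x.
Proof.
move=> hG [Bs [Bnbhs Bbasis] Bq] x x0.
have [V [W [V0 W0 VW]]] : exists V W : set G,
    [/\ nbhs x V, nbhs 0 W & forall z, V z -> ~ W z].
  apply: contrapT => noVW; move/eqP: x0; apply; apply: hG => V W Vx W0.
  apply: contrapT => VW; apply: noVW; exists V, W; split=> // z Vz Wz.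
  by apply: VW; exists z.
have [A BA AW] := Bbasis W W0.
have [|chi [cchi chiA chix]] := Bq A BA x.
  by move=> /AW; apply: VW; exact: nbhs_singleton.
exists (chi @^-1` circle_plus R) => //.
by apply: char_filter_char => //; exact: nbhs0_circle_plus.
Qed.

End CharacterFilter.

Lemma locally_quasi_convex_almost_minimal (R : realType)
    (G : topologicalZmodType) :
  complete_group G -> locally_quasi_convex R G -> locally_minimal G ->
  almost_minimal G.
Proof.
move=> complG lqcG [hG [V0 V00 minV]]; have [Bs [Bnbhs Bbasis] Bq] := lqcG.
have [U BU UV0] := Bbasis V0 V00.
have qU := Bq U BU; have U0 : nbhs 0 U := Bnbhs U BU.
pose F := char_filter R U.
have FF : Filter F := char_filter_filter R U.
have F00 A : F A -> A 0.
  by move=> /(char_filter_nbhs U0); exact: nbhs_singleton.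
have Fsub := char_filter_sub qU.
have topF : topen (filter_topology FF) = @open G.
  apply: minV.
  - apply: filter_topology_group => //; exact: char_filter_separated.
  - move=> O oO; rewrite openE => x /oO /(char_filter_nbhs U0) /(nbhs0_shift x).
    by apply: filterS => y; rewrite /= addrC subrK.
  - apply/(filter_topology_nbhs (FF := FF) F00 Fsub).
    have F1 : F (one_nth 1 U) by exact: char_filter_one_nth.
    apply: (filterS _ F1) => x /(_ 1%N); rewrite mulr1n /= add0r.
    by move=> /(_ isT)/UV0.
have nbhsF A : nbhs 0 A -> F A.
  rewrite nbhsE => -[O [oO Oz] OA]; rewrite -topF in oO.
  have FO : F [set y | O (0 + y)] := oO 0 Oz.
  by apply: (filterS _ FO) => y; rewrite /= add0r; exact: OA.
have clU := quasi_convex_closed qU.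
have lim (Psi : set_system G) : UltraFilter Psi ->
    (forall n, Psi (one_nth n U)) ->
    exists2 y, (\bigcap_n one_nth n U) y & Psi --> y.
  move=> PU Pn.
  (* Along each character the image ultrafilter converges in the compact circle, so [Psi] is
     Cauchy. *)
  have [|y Py] := complG Psi _.
    move=> E [W W0 WE].
    have [chi cchi|B PB BW] :=
        @char_filter_difference R G U qU Psi _ Pn _ W (nbhsF W W0).
      have := @circle_compact R; rewrite compact_ultra.
      move=> /(_ (chi @ Psi) (ultra_fmap chi PU) filterT)[l [_ Pl]].
      by exists l.
    exists (B, B) => // -[x y] [/= Bx By]; apply: WE; exact: BW.
  exists y => // n _.
  by apply: (closed_cvg _ (one_nth_closed (n := n) clU) _ _ Py); exact: Pn.
have [N NE] : exists N : zmodClosed G,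
    [set x | x \in N] = \bigcap_n one_nth n U.
  apply: zmodClosed_of_set => [n _ k _|x y Nx Ny n _].
    by rewrite mul0rn; exact: nbhs_singleton.
  by apply: (quasi_convex_one_nthB qU); [exact: Nx|exact: Ny].
have inN x : x \in N = (\bigcap_n one_nth n U) x :> Prop by rewrite -NE.
(* [V] is [H + N], which makes it invariant under [N]. The index 2 puts [V] inside (1/1)U, so an
   ultrafilter containing every (1/n)V contains every (1/n)U. *)
pose H := one_nth 2 U `&` -%R @^-1` one_nth 2 U.
pose V := [set x | exists2 y, y \in N & H (x - y)].
have VU : V `<=` U.
  move=> x [y yN [Hxy Hyx]]; rewrite -[x]mulr1n -(subrK y x) -[y in _ + y]opprK.
  apply: (quasi_convex_one_nthB (n := 1) qU) => //.
  by have := rpredNr yN; rewrite inN; exact.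
apply: (@almost_minimal_ultra G N V) => //.
- have H0 : nbhs 0 H.
    apply: filterI; first exact: nbhs_one_nth.
    by apply: (@opp_continuous G); rewrite oppr0; exact: nbhs_one_nth.
  by apply: filterS H0 => x Hx; exists 0; rewrite ?subr0 ?rpred0.
- move=> x [y yN [Hxy Hyx]]; exists (- y); first by rewrite rpredN.
  by split; rewrite /= -opprD ?opprK.
- move=> x z [y yN Hxy] zN; exists (y + z); first exact: rpredD.
  by rewrite opprD addrACA subrr addr0.
move=> Psi PU PV; have [n|y] := lim Psi PU.
  by apply: filterS (PV n); exact: one_nthS.
by rewrite -NE => yN Py; exists y.
Qed.

(** * Locally compact groups *)

Section CompactSets.
Variable G : topologicalZmodType.
Implicit Types (A B U V W K : set G).

Definition sumset A B : set G := [set a + b | a in A & b in B].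

Lemma compact_sumset A B : compact A -> compact B -> compact (sumset A B).
Proof.
move=> cA cB; have -> : sumset A B = (fun z : G * G => z.1 + z.2) @` (A `*` B).
  apply/seteqP; split=> [_ [a Aa [b Bb <-]]|_ [[a b] [/= Aa Bb] <-]].
    by exists (a, b).
  by exists a => //; exists b.
apply: continuous_compact; last exact: compact_setX.
by apply: continuous_subspaceT => x; exact: add_continuous.
Qed.

Lemma compact_oppset A : compact A -> compact [set - x | x in A].
Proof.
move=> cA; apply: continuous_compact => //.
by apply: continuous_subspaceT => x; exact: opp_continuous.
Qed.

(** Otherwise the complements in [K] of finite unions of translates of [W] generate a proper filter;
    an ultrafilter above it has a limit [x] in [K], yet avoids [x + W]. *)
Lemma compact_translates K W : compact K -> nbhs 0 W ->
  exists s : seq G, forall x, K x -> exists2 i, i \in s & W (x - i).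
Proof.
rewrite compact_ultra => cK W0; apply: contrapT => nos.
pose B (s : seq G) := K `&` [set x | forall i, i \in s -> ~ W (x - i)].
have FB : ProperFilter (filter_from [set: seq G] B).
  apply: filter_from_proper.
    apply: filter_from_filter; first by exists [::].
    move=> s t _ _; exists (s ++ t) => // x [Kx nx].
    by split; split=> // i ii; apply: nx; rewrite mem_cat ii ?orbT.
  move=> s _; apply: contrapT => B0; apply: nos; exists s => x Kx.
  apply: contrapT => nx; apply: B0; exists x; split=> // i si Wi.
  by apply: nx; exists i.
have [F [FU BF]] := ultraFilterLemma FB.
have [|x [Kx Fx]] := cK F FU; first by apply: BF; exists [::] => // x [].
have FBx : F (B [:: x]) by apply: BF; exists [:: x].
have [y [[_ nWy] Wy]] := filter_ex (filterI FBx (Fx _ (nbhs0_shift x W0))).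
by apply: (nWy x) => //; rewrite inE.
Qed.

End CompactSets.

(** * Weil's lemma for the multiples of one element *)

Section Weil.
Variables (G : topologicalZmodType) (A : zmodType) (phi : {additive A -> G}).
Variable g : G.
Implicit Types U V W K : set G.

(** The exponents [n] for which the class of [n g] modulo the range of [phi] meets [W]. *)
Definition hits W : set int := [set n | exists a, W (g *~ n + phi a)].

Lemma hitsB V W m n : (forall x y, V x -> V y -> W (x - y)) ->
  hits V m -> hits V n -> hits W (m - n).
Proof.
move=> VW [a Va] [b Vb]; exists (a - b).
by rewrite mulrzBr raddfB addrACA -opprD; exact: VW.
Qed.

Lemma hits_finite K W : compact K -> nbhs 0 W ->
  exists s : seq int, forall n, hits K n ->
    exists2 k : int, k \in s & hits W (n - k).
Proof.
move=> cK W0; have [V [V0 _ VW]] := nbhs0_sub W0.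
have [s sK] := compact_translates cK V0.
pose P i : set int := [set k | exists a, V (g *~ k + phi a - i)].
(* One exponent is chosen for each translate [i + V]; the default 0 occurs only for translates that
   no exponent reaches. *)
exists [seq xget 0 (P i) | i <- s] => n [a Ka].
have [i si Vi] := sK _ Ka.
exists (xget 0 (P i)); first exact: map_f.
have [b Vb] : P i (xget 0 (P i)) by apply: xgetPex; exists n, a.
exists (a - b); rewrite mulrzBr raddfB addrACA -opprD.
by rewrite -(subrKA i) -[i - _]opprB; exact: VW.
Qed.

Lemma hits_bounded K W M : compact K -> nbhs 0 W ->
    (forall n, hits W n -> (`|n| <= M)%N) ->
  exists M', forall n, hits K n -> (`|n| <= M')%N.
Proof.
move=> cK W0 WM; have [s sK] := hits_finite cK W0.
exists (M + \max_(k <- s) `|k|)%N => n /sK[k ks /WM].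
have : (`|k| <= \max_(k <- s) `|k|)%N by exact: leq_bigmax_seq.
lia.
Qed.

(* Weil's lemma modulo the range of [phi]: the classes of the multiples of [g]
   are either discrete or relatively compact. *)
Lemma hits_dichotomy U : compact U -> nbhs 0 U -> (forall x, U x -> U (- x)) ->
  (exists2 W, nbhs 0 W & exists M, forall n, hits W n -> (`|n| <= M)%N) \/
  (exists2 K, compact K & forall n, hits K n).
Proof.
move=> cU U0 symU; set P := (X in X \/ _).
have [|unbdd] := pselect P; [by left|right; rewrite {}/P in unbdd].
have hitsN W n : (forall x, W x -> W (- x)) -> hits W n -> hits W (- n).
  by move=> sW [a Wa]; exists (- a); rewrite mulrNz raddfN -opprD; exact: sW.
have large W M : nbhs 0 W -> (forall x, W x -> W (- x)) ->
    exists2 n : nat, hits W n & (M < n)%N.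
  move=> W0 sW; apply: contrapT => noM; apply: unbdd; exists W => //.
  exists M => n Wn; rewrite leqNgt; apply/negP => Mn; apply: noM.
  exists `|n|%N => //; case: n Wn {Mn} => n //=.
  by rewrite NegzE => /(hitsN _ _ sW); rewrite opprK.
have [V [V0 sV VU]] := nbhs0_sub U0.
have [s sU] := hits_finite cU V0.
have [t Vt tM] := large V (\max_(k <- s) `|k|)%N V0 sV.
pose N := (\max_(k <- s) `|k| + t)%N.
(* Some [k] in [s] has [n - k] in [hits V], and subtracting [t] stays in [hits U]. As [t] exceeds
   every [|k|], the decrement [k + t] lies between 1 and [N]. *)
have step n : hits U n -> exists j : nat, (0 < j <= N)%N /\ hits U (n - j%:Z).
  move=> /sU[k ks Vk].
  have kM : (`|k| <= \max_(k <- s) `|k|)%N by exact: leq_bigmax_seq.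
  exists `|(k + t%:Z)%R|%N; split; first by rewrite /N; lia.
  have -> : n - `|(k + t%:Z)%R|%N%:Z = n - k - t%:Z by lia.
  exact: hitsB VU Vk Vt.
exists (sumset U [set g *+ t | t in `I_N.+1]).
  apply: compact_sumset => //; apply: finite_compact.
  by apply: finite_image; exact: finite_II.
move=> n.
(* Let [r] be the least positive integer with [r - n] in [hits U]. By [step] and minimality
   [r <= N], and by symmetry [n - r] is in [hits U], so [n g] lies in [U + r g] modulo the range of
   [phi]. *)
pose P (t : nat) := (0 < t)%N && `[< hits U (t%:Z - n) >].
have exP : exists t, P t.
  have [m Um nm] := large U `|n|%N U0 symU.
  exists `|(m%:Z + n)%R|%N; apply/andP; split; first by lia.
  by apply/asboolP; have -> : `|(m%:Z + n)%R|%N%:Z - n = m%:Z by lia.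
case: (ex_minnP exP) => r /andP[r0 /asboolP Ur] rmin.
have rN : (r <= N)%N.
  have [j [jN Uj]] := step _ Ur; have [rj|jr] := leqP r j; first by lia.
  have : P (r - j)%N.
    apply/andP; split; first by lia.
    by apply/asboolP; have -> : (r - j)%N%:Z - n = r%:Z - n - j%:Z by lia.
  by move=> /rmin; lia.
have [a Ua] := hitsN _ _ symU Ur.
exists a; exists (g *~ (- (r%:Z - n)) + phi a) => //.
exists (g *+ r); first by exists r.
by rewrite opprB mulrzBr -pmulrn addrAC subrK.
Qed.

End Weil.

(* A stands for Z^r with the l1-norm N, embedded in G as a discrete subgroup. *)
Record proper_lattice (G : topologicalZmodType) (A : zmodType)
    (phi : {additive A -> G}) (N : A -> nat) : Prop := {
  sizeD : forall a b, (N (a + b)%R <= N a + N b)%N;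
  sizeMn : forall a k, N (a *+ k) = (k * N a)%N;
  sizeN : forall a, N (- a) = N a;
  size_compact : forall K, compact K ->
    exists M, forall a, K (phi a) -> (N a <= M)%N;
  compact_size : forall M,
    exists2 K, compact K & forall a, (N a <= M)%N -> K (phi a)
}.

(** * Lattices modulo compact sets *)

Section CompactElements.
Variable G : topologicalZmodType.
Implicit Types C H U V W K : set G.

Lemma trivial_lattice :
  exists (A : zmodType) (phi : {additive A -> G}) N, proper_lattice phi N.
Proof.
exists 'rV[int]_0, \0, (fun=> 0%N); split=> // [a k|K _|M].
- by rewrite muln0.
- by exists 0%N.
- by exists [set 0] => //; exact: compact_set1.
Qed.

Definition extend_lattice (A : zmodType) (phi : A -> G) (g : G)
  (x : int * A) : G := g *~ x.1 + phi x.2.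

Lemma extend_lattice_is_zmod_morphism (A : zmodType) (phi : {additive A -> G})
  g : zmod_morphism (extend_lattice phi g).
Proof.
by move=> x y; rewrite /extend_lattice /= mulrzBr raddfB addrACA opprD.
Qed.

HB.instance Definition _ (A : zmodType) (phi : {additive A -> G}) g :=
  GRing.isZmodMorphism.Build _ _ (extend_lattice phi g)
    (extend_lattice_is_zmod_morphism phi g).

Lemma int_segment_finite M : finite_set [set n : int | (`|n| <= M)%N].
Proof.
pose f (i : nat) : int := i%:Z - M%:Z.
apply: (@sub_finite_set _ _ (f @` `I_(M + M).+1)).
  by move=> n /= nM; exists `|(n + M%:Z)%R|%N; rewrite /f /=; lia.
by apply: finite_image; exact: finite_II.
Qed.

Lemma compact_segment (g : G) M :
  compact [set g *~ n | n in [set n : int | (`|n| <= M)%N]].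
Proof.
by apply: finite_compact; apply: finite_image; exact: int_segment_finite.
Qed.

(** The bound on [hits] limits the first coordinate on a compact set; subtracting the finitely many
    possible multiples of [g] leaves the second coordinate over a compact set. *)
Lemma proper_extend_lattice (A : zmodType) (phi : {additive A -> G}) N g W M :
  nbhs 0 W -> (forall n, hits phi g W n -> (`|n| <= M)%N) ->
  proper_lattice phi N ->
  proper_lattice (extend_lattice phi g) (fun x => `|x.1| + N x.2)%N.
Proof.
move=> W0 WM pphi; split=> /=.
- by move=> a b; have := sizeD pphi a.2 b.2; lia.
- move=> [n a] k; rewrite /= (_ : (n, a) *+ k = (n *+ k, a *+ k)); last first.
    by elim: k => [|k IH]; rewrite ?mulr0n// !mulrS IH.
  by rewrite /= (sizeMn pphi) -mulr_natr mulnDr; lia.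
- by move=> [n a]; rewrite /= (sizeN pphi); lia.
- move=> K cK; have [M1 KM1] := hits_bounded cK W0 WM.
  have cS := @compact_segment g M1.
  have [M2 KM2] := size_compact pphi (compact_sumset cK (compact_oppset cS)).
  exists (M1 + M2)%N => -[n a] Kna; apply: leq_add.
    by apply: KM1; exists a.
  apply: KM2; exists (g *~ n + phi a); first exact: Kna.
  exists (- (g *~ n)); last by rewrite addrAC subrr add0r.
  by exists (g *~ n) => //; exists n => //=; apply: KM1; exists a.
- move=> M1; have [K cK KM] := compact_size pphi M1.
  exists (sumset [set g *~ n | n in [set n : int | (`|n| <= M1)%N]] K).
    by apply: compact_sumset => //; exact: compact_segment.
  move=> [n a] /= naM; exists (g *~ n); first by exists n => //=; lia.
  by exists (phi a) => //; apply: KM; lia.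
Qed.

(** The subgroup generated by [s], built one generator at a time. *)
Fixpoint combinations (s : seq G) : set G :=
  if s is g :: s' then
    [set g *~ n + y | n in [set: int] & y in combinations s']
  else [set 0].

Lemma combinations0 s : combinations s 0.
Proof. by elim: s => //= g s IH; exists 0 => //; exists 0; rewrite ?addr0. Qed.

Lemma combinationsB s x y :
  combinations s x -> combinations s y -> combinations s (x - y).
Proof.
elim: s x y => [|g s IH] x y /=; first by move=> -> ->; rewrite subr0.
move=> [m _ [u su <-]] [n _ [v sv <-]]; exists (m - n) => //.
by exists (u - v); [exact: IH|rewrite mulrzBr addrACA -opprD].
Qed.

Lemma mem_combinations s x : x \in s -> combinations s x.
Proof.
elim: s => //= g s IH; rewrite inE => /predU1P[->|/IH sx].
  by exists 1 => //; exists 0; [exact: combinations0|rewrite addr0].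
by exists 0 => //; exists x; rewrite ?add0r.
Qed.

(** By induction on the generators: by [hits_dichotomy], a new [g] either adds one to the rank of
    the lattice or has all its multiples in a compact set modulo the lattice. *)
Lemma combinations_lattice U s :
  compact U -> nbhs 0 U -> (forall x, U x -> U (- x)) ->
  exists (A : zmodType) (phi : {additive A -> G}) N K,
    [/\ proper_lattice phi N, compact K &
        forall x, combinations s x -> exists a, K (x - phi a)].
Proof.
move=> cU U0 symU; elim: s => [|g s [A [phi [N [K [pphi cK Ks]]]]]].
  have [A [phi [N pphi]]] := trivial_lattice.
  exists A, phi, N, [set 0]; split=> //; first exact: compact_set1.
  by move=> x ->; exists 0; rewrite raddf0 subr0.
have [[W W0 [M WM]]|[K' cK' hK']] := hits_dichotomy phi g cU U0 symU.
  exists (int * A)%type, (extend_lattice phi g).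
  exists (fun x => `|x.1| + N x.2)%N, K; split=> //.
    exact: (proper_extend_lattice W0 WM pphi).
  move=> _ [n _ [y /Ks[a Ka] <-]]; exists (n, a).
  by rewrite /= /extend_lattice/= opprD addrACA subrr add0r.
exists A, phi, N, (sumset K' K); split=> //; first exact: compact_sumset.
move=> _ [n _ [y /Ks[a Ka] <-]]; have [b Kb] := hK' n.
exists (a - b); exists (g *~ n + phi b) => //; exists (y - phi a) => //.
by rewrite raddfB opprB addrACA [phi b - _]addrC.
Qed.

(* The bound does not depend on the compact set [C]: coordinates are additive up
   to an error bounded by [M], and bounded along the multiples of [x]. *)
Lemma bounded_multiples_coordinate (A : zmodType) (phi : {additive A -> G})
    N H K :
  proper_lattice phi N -> compact K ->
  (forall x y, H x -> H y -> H (x + y)) ->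
  (forall x, H x -> exists a, K (x - phi a)) ->
  exists M, forall x C, H x -> compact C -> (forall k, C (x *+ k)) ->
    exists2 a, K (x - phi a) & (N a <= M)%N.
Proof.
move=> pphi cK HD HK.
have [M phiM] := size_compact pphi
  (compact_sumset (compact_sumset cK cK) (compact_oppset cK)).
exists M => x C Hx cC Cx; have [a Ka] := HK x Hx; exists a => //.
(* Each further multiple of [x] adds an error of size at most [M], because the defect of additivity
   is a lattice point in [K + K - K]. *)
have coord m : exists2 b,
    K (x *+ m.+1 - phi b) & (N (b - a *+ m.+1)%R <= m * M)%N.
  elim: m => [|m [b Kb Nb]].
    by exists a; rewrite // subrr -[0](mulr0n a) (sizeMn pphi).
  have Hm : H (x *+ m.+2).
    by elim: m.+1 => // k Hk; rewrite mulrS; exact: HD.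
  have [c Kc] := HK _ Hm; exists c => //.
  have : (N (c - b - a)%R <= M)%N.
    apply: phiM; rewrite !raddfB.
    exists (x *+ m.+1 - phi b + (x - phi a)).
      by exists (x *+ m.+1 - phi b) => //; exists (x - phi a).
    exists (- (x *+ m.+2 - phi c)); first by exists (x *+ m.+2 - phi c).
    by rewrite addrACA -mulrSr opprB [LHS]addrC addrA subrK addrA.
  have -> : c - a *+ m.+2 = (c - b - a) + (b - a *+ m.+1).
    by rewrite mulrS opprD addrA [c - b - a]addrAC subrKA.
  by move=> NM; apply: leq_trans (sizeD pphi _ _) _; rewrite mulSn leq_add.
(* [P] bounds the coordinates of all multiples of [x], as these lie in [C - K]. Taking the multiple
   [P.+1] gives [(P+1) N(a) <= P (M+1)], which excludes [N(a) >= M+1]. *)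
have [P phiP] := size_compact pphi (compact_sumset cC (compact_oppset cK)).
have [b Kb Nb] := coord P.
have NP : (N b <= P)%N.
  apply: phiP; exists (x *+ P.+1) => //; exists (- (x *+ P.+1 - phi b)).
    by exists (x *+ P.+1 - phi b).
  by rewrite opprB subrKC.
have : (P.+1 * N a <= P + P * M)%N.
  rewrite -(sizeMn pphi) -(subKr b (a *+ _)).
  by apply: leq_trans (sizeD pphi _ _) _; rewrite (sizeN pphi) leq_add.
rewrite leqNgt [(N a <= _)%N]leqNgt; apply: contraNN => MN.
have : (P.+1 * M.+1 <= P.+1 * N a)%N by rewrite leq_mul2l MN orbT.
nia.
Qed.

End CompactElements.

(** * The subgroup of compact elements *)

Section LocallyCompact.
Variable G : topologicalZmodType.
Implicit Types C H U V W K : set G.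

Lemma compact_symmetric_nbhs0 : hausdorff_space G -> locally_compact [set: G] ->
  exists U, [/\ compact U, nbhs 0 U & forall x, U x -> U (- x)].
Proof.
move=> hG /(_ 0 I)[K K0 [cK clK]].
have {}K0 : nbhs 0 K.
  by move: K0; rewrite /within /=; apply: filterS => x; exact.
have NK0 : nbhs 0 (-%R @^-1` K) by apply: (@opp_continuous G); rewrite oppr0.
exists (K `&` -%R @^-1` K); split.
- apply: compact_closedI => //.
  by apply: closed_comp => // x _; exact: opp_continuous.
- exact: filterI.
- by move=> x [Kx NKx]; split; rewrite //= opprK.
Qed.

Lemma locally_compact_almost_minimal :
  hausdorff_space G -> locally_compact [set: G] -> almost_minimal G.
Proof.
move=> hG /(compact_symmetric_nbhs0 hG)[U [cU U0 symU]].
have Uz := nbhs_singleton U0.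
have [s sU] := compact_translates (compact_sumset cU cU) U0.
(* Since [U + U] is covered by the translates [i + U] with [i] in [s], adding the subgroup generated
   by [s] to [U] gives a subgroup, which is open because it contains [U]. *)
pose H := sumset U (combinations s).
have HB x y : H x -> H y -> H (x - y).
  move=> [u Uu [v sv <-]] [w Uw [z sz <-]].
  have [|i si Ui] := sU (u - w).
    by exists u => //; exists (- w) => //; exact: symU.
  exists (u - w - i) => //; exists (i + (v - z)).
    rewrite -[i]opprK addrC; apply: combinationsB; first exact: combinationsB.
    rewrite -sub0r; apply: combinationsB; first exact: combinations0.
    exact: mem_combinations.
  by rewrite addrA subrK addrACA -opprD.
have UH : U `<=` H.
  move=> u Uu; exists u => //; exists 0; first exact: combinations0.
  by rewrite addr0.
have HD x y : H x -> H y -> H (x + y).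
  move=> Hx Hy; rewrite -[y]opprK; apply: (HB) => //; rewrite -sub0r.
  by apply: HB => //; exact: UH.
have [A [phi [N [K0 [pphi cK0 sK0]]]]] := combinations_lattice s cU U0 symU.
have HK x : H x -> exists a, sumset U K0 (x - phi a).
  move=> [u Uu [v sv <-]]; have [a Ka] := sK0 v sv.
  by exists a, u => //; exists (v - phi a) => //; rewrite addrA.
have cK := compact_sumset cU cK0.
have [M boundM] := bounded_multiples_coordinate pphi cK HD HK.
have [K1 cK1 NK1] := compact_size pphi M.
pose L := sumset (sumset U K0) K1.
have cL : compact L by exact: compact_sumset.
pose B : set G := H `&` [set x | exists2 C, compact C & forall k, C (x *+ k)].
have B0 : B 0.
  split; first exact: UH.
  by exists [set 0]; [exact: compact_set1|move=> k; rewrite mul0rn].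
have BB x y : B x -> B y -> B (x - y).
  move=> [Hx [C cC Cx]] [Hy [C' cC' Cy]]; split; first exact: HB.
  exists (sumset C [set - z | z in C']).
    by apply: compact_sumset => //; exact: compact_oppset.
  move=> k; exists (x *+ k) => //; exists (- (y *+ k)); last by rewrite mulrnBl.
  by exists (y *+ k).
have BD x y : B x -> B y -> B (x + y).
  by move=> Bx By; rewrite -[y]opprK -(sub0r y); do ?apply: (BB).
have BMn x k : B x -> B (x *+ k).
  by move=> Bx; elim: k => // k IH; rewrite mulrS; exact: BD.
have BL : B `<=` L.
  move=> x [Hx [C cC Cx]]; have [a Ka Na] := boundM x C Hx cC Cx.
  by exists (x - phi a) => //; exists (phi a); [exact: NK1|rewrite subrK].
have cB : compact B.
  apply: (subclosed_compact _ cL BL).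
  (* The single compact set [L] serves all elements of [B], so [B] is cut out by closed
     conditions. *)
  have -> : B = H `&` \bigcap_(k in [set: nat]) [set x | L (x *+ k)].
    apply/seteqP; split=> x [Hx Lx]; split=> //; last first.
      by exists L => // k; exact: Lx.
    by move=> k _; apply: BL; apply: BMn; split.
  apply: closedI; first exact: (open_subgroup_closed U0 UH HB).
  apply: closed_bigI => k _; apply: closed_preimage_mulrn.
  exact: compact_closed.
have [S SB] := zmodClosed_of_set B0 BB.
have inS x : x \in S = B x :> Prop by rewrite -SB.
have cV : compact (sumset U B) by exact: compact_sumset.
have clV := compact_closed hG cV.
apply: (@almost_minimal_ultra G S (sumset U B)) => //.
- by apply: filterS U0 => u Uu; exists u => //; exists 0; rewrite ?addr0.
- move=> _ [u Uu [b Bb <-]]; exists (- u); first exact: symU.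
  by exists (- b); [rewrite -sub0r; exact: BB|rewrite opprD].
- move=> _ y [u Uu [b Bb <-]]; rewrite inS => By.
  by exists u => //; exists (b + y); [exact: BD|rewrite addrA].
move=> F FU FV; move: (cV); rewrite compact_ultra => /(_ F FU)[|x [Vx Fx]].
  by apply: filterS (FV 1%N) => x /(_ 1%N); rewrite mulr1n; exact.
exists x => //; rewrite inS; split.
  by case: Vx => u Uu [b [Hb _] <-]; apply: HD => //; exact: UH.
(* The limit [x] stays in every closed set (1/n)V, so its positive multiples lie in the compact set
   [U + B]; the multiple 0 is checked apart. *)
exists (sumset U B) => // -[|k].
  by rewrite mulr0n; exists 0 => //; exists 0; rewrite ?addr0.
have : one_nth k.+1 (sumset U B) x.
  apply: (closed_cvg _ (one_nth_closed (n := k.+1) clV) _ _ Fx).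
  exact: FV.
by apply; rewrite /= leqnn.
Qed.

End LocallyCompact.

Theorem corollary6p14 (R : realType) :
  (forall G : topologicalZmodType,
     complete_group G -> locally_quasi_convex R G -> locally_minimal G ->
     almost_minimal G) /\
  (forall G : topologicalZmodType,
     hausdorff_space G -> locally_compact [set: G] -> almost_minimal G).
Proof.
split; first exact: locally_quasi_convex_almost_minimal.
exact: locally_compact_almost_minimal.
Qed.
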